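(* Let $\Gamma\Rightarrow A$ be an $\mathsf{acLL}^+_\Sigma$ sequent, where the signature $\Sigma$ may include labels licensing $\mathsf{A1}$ and $\mathsf{A2}$. If $\vdash(\widehat{\Gamma}^{\perp},\widehat{A})$ is provable in $\mathsf{CacLL}_\Sigma$, then $\Gamma\Rightarrow A$ is provable in $\mathsf{acLL}^+_\Sigma$.
   Context: $\mathsf{CacLL}_\Sigma$ is the one-sided classical non-associative non-commutative linear logic with subexponentials over a signature $\Sigma=(I,\preceq,f)$, $f:I\to 2^{\{\mathsf{C},\mathsf{W},\mathsf{A1},\mathsf{A2},\mathsf{E}\}}$ upward closed; sequents $\vdash\Gamma$ with binary-tree structures, connectives $\otimes$, par $⅋$, $\oplus$, with $\mathbin{\&}$, units, subexponentials $!^i,?^i$, top-level exchange/associativity, and $?$-licensed structural rules. $\mathsf{acLL}_\Sigma$ is the intuitionistic two-sided counterpart with sequents $\Gamma\Rightarrow A$ (structure antecedent, single succedent) and connectives $\mathbin{\&},\oplus,\otimes,\to,\leftarrow,\top,!^i,\mathsf{1}$. $\mathsf{acLL}^+_\Sigma$ consists of all rules of $\mathsf{acLL}_\Sigma$ except its two associativity rules, plus the six rules (each from premise to conclusion within a context $\Gamma\{\}$, succedent $G$): A1L from $((!^{a1}\Delta_1,\Delta_2),\Delta_3)$ to $(!^{a1}\Delta_1,(\Delta_2,\Delta_3))$; A1M from $(\Delta_1,(!^{a1}\Delta_2,\Delta_3))$ to $((\Delta_1,!^{a1}\Delta_2),\Delta_3)$; A1R from $((\Delta_1,\Delta_2),!^{a1}\Delta_3)$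 to $(\Delta_1,(\Delta_2,!^{a1}\Delta_3))$; A2L from $(!^{a2}\Delta_1,(\Delta_2,\Delta_3))$ to $((!^{a2}\Delta_1,\Delta_2),\Delta_3)$; A2M from $((\Delta_1,!^{a2}\Delta_2),\Delta_3)$ to $(\Delta_1,(!^{a2}\Delta_2,\Delta_3))$; A2R from $(\Delta_1,(\Delta_2,!^{a2}\Delta_3))$ to $((\Delta_1,\Delta_2),!^{a2}\Delta_3)$, where $\mathsf{A1}\in f(a1)$, $\mathsf{A2}\in f(a2)$. The translation: $\widehat{p}=p$, $\widehat{A\otimes B}=\widehat{A}\otimes\widehat{B}$, $\widehat{A\to B}=\widehat{A}^{\perp}⅋\widehat{B}$, $\widehat{B\leftarrow A}=\widehat{B}⅋\widehat{A}^{\perp}$, $\widehat{A\mathbin{\&}B}=\widehat{A}\mathbin{\&}\widehat{B}$, $\widehat{A\oplus B}=\widehat{A}\oplus\widehat{B}$, $\widehat{!^iA}=!^i\widehat{A}$, $\widehat{\mathsf{1}}=\mathsf{1}$, $\widehat{\top}=\top$, with $\widehat{(\Gamma,\Delta)}^{\perp}=(\widehat{\Delta}^{\perp},\widehat{\Gamma}^{\perp})$ on structures. *)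

(* Defs.v *)
From Stdlib Require Import Relations.

Set Implicit Arguments.

(** * Subexponential signatures *)

Inductive axm : Set := axC | axW | axA1 | axA2 | axE.

(** [licenses i a] is [a \in f(i)]. *)
Record signature := Signature {
  label : Type;
  label_le : label -> label -> Prop;
  licenses : label -> axm -> Prop;
  label_le_preorder : preorder label label_le;
  licenses_up : forall i j a, label_le i j -> licenses i a -> licenses j a
}.

(** * Binary-tree structures

    Structures may be empty and the empty structure is a unit of the comma:
    [(Γ, ())], [((), Γ)] and [Γ] are the same structure.  A structure is hence
    either empty ([None]) or a binary tree whose leaves are formulas, and
    [comma] is a unital, but neither associative nor commutative, product. *)

Inductive tree (F : Type) : Type :=
| leaf (A : F)
| node (s t : tree F).

Definition struct (F : Type) : Type := option (tree F).

Definition empty {F : Type} : struct F := None.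

Definition fml {F : Type} (A : F) : struct F := Some (leaf A).

Definition comma {F : Type} (G D : struct F) : struct F :=
  match G, D with
  | None, _ => D
  | _, None => G
  | Some s, Some t => Some (node s t)
  end.

Inductive ctx (F : Type) : Type :=
| hole
| ctx_l (c : ctx F) (D : struct F)
| ctx_r (D : struct F) (c : ctx F).

Fixpoint plug {F : Type} (c : ctx F) (X : struct F) : struct F :=
  match c with
  | hole _ => X
  | ctx_l c D => comma (plug c X) D
  | ctx_r D c => comma D (plug c X)
  end.

Fixpoint tree_all {F : Type} (P : F -> Prop) (t : tree F) : Prop :=
  match t with
  | leaf A => P A
  | node s t => tree_all P s /\ tree_all P t
  end.

(** Every formula occurring in the structure satisfies [P]. *)
Definition struct_all {F : Type} (P : F -> Prop) (G : struct F) : Prop :=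
  match G with
  | None => True
  | Some t => tree_all P t
  end.

Declare Scope struct_scope.
Delimit Scope struct_scope with struct.
Bind Scope struct_scope with struct.
Notation "G ,, D" := (comma G D) (at level 70, no associativity) : struct_scope.
Notation "c [[ D ]]" := (plug c D) (at level 8, D at level 99, left associativity,
  format "c [[ D ]]") : struct_scope.
Open Scope struct_scope.

(** * The intuitionistic system acLL+ *)

Inductive iform (Atom I : Type) : Type :=
| iatom (p : Atom)
| itens (A B : iform Atom I)
| ito (A B : iform Atom I)     (* [A → B] *)
| ifrom (B A : iform Atom I)   (* [B ← A] *)
| iwith (A B : iform Atom I)
| iplus (A B : iform Atom I)
| ibang (i : I) (A : iform Atom I)
| ione
| itop.

Arguments iatom {Atom I} p.
Arguments ione {Atom I}.
Arguments itop {Atom I}.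

Section Intuitionistic.
Variables (Atom : Type) (Sg : signature).

Notation form := (iform Atom (label Sg)).

(** [bang_all P G] : every formula of [G] is of the form [!^j B] with [P j]. *)
Definition bang_all (P : label Sg -> Prop) : struct form -> Prop :=
  struct_all (fun A => match A with ibang j _ => P j | _ => False end).

Definition bang_lic (a : axm) : struct form -> Prop :=
  bang_all (fun j => licenses Sg j a).

Inductive acLLp : struct form -> form -> Prop :=
| i_init A : acLLp (fml A) A
| i_tensL c A B C :
    acLLp c[[(fml A,, fml B)]] C -> acLLp c[[fml (itens A B)]] C
| i_tensR G D A B :
    acLLp G A -> acLLp D B -> acLLp (G,, D) (itens A B)
| i_toL c D A B C :
    acLLp D A -> acLLp c[[fml B]] C -> acLLp c[[(D,, fml (ito A B))]] C
| i_toR G A B :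
    acLLp (fml A,, G) B -> acLLp G (ito A B)
| i_fromL c D A B C :
    acLLp D A -> acLLp c[[fml B]] C -> acLLp c[[(fml (ifrom B A),, D)]] C
| i_fromR G A B :
    acLLp (G,, fml A) B -> acLLp G (ifrom B A)
| i_withL1 c A B C :
    acLLp c[[fml A]] C -> acLLp c[[fml (iwith A B)]] C
| i_withL2 c A B C :
    acLLp c[[fml B]] C -> acLLp c[[fml (iwith A B)]] C
| i_withR G A B :
    acLLp G A -> acLLp G B -> acLLp G (iwith A B)
| i_plusL c A B C :
    acLLp c[[fml A]] C -> acLLp c[[fml B]] C -> acLLp c[[fml (iplus A B)]] C
| i_plusR1 G A B :
    acLLp G A -> acLLp G (iplus A B)
| i_plusR2 G A B :
    acLLp G B -> acLLp G (iplus A B)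
| i_oneL c C :
    acLLp c[[empty]] C -> acLLp c[[fml ione]] C
| i_oneR : acLLp empty ione
| i_topR G : acLLp G itop
| i_bangR i G A :
    bang_all (label_le Sg i) G -> acLLp G A -> acLLp G (ibang i A)
| i_bangL i c A C :
    acLLp c[[fml A]] C -> acLLp c[[fml (ibang i A)]] C
| i_W c D C :
    bang_lic axW D -> acLLp c[[empty]] C -> acLLp c[[D]] C
| i_C c D C :
    bang_lic axC D -> acLLp c[[(D,, D)]] C -> acLLp c[[D]] C
| i_E1 c D1 D2 C : bang_lic axE D1 ->
    acLLp c[[(D2,, D1)]] C -> acLLp c[[(D1,, D2)]] C
| i_E2 c D1 D2 C : bang_lic axE D1 ->
    acLLp c[[(D1,, D2)]] C -> acLLp c[[(D2,, D1)]] C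
| i_A1L c D1 D2 D3 C : bang_lic axA1 D1 ->
    acLLp c[[((D1,, D2),, D3)]] C -> acLLp c[[(D1,, (D2,, D3))]] C
| i_A1M c D1 D2 D3 C : bang_lic axA1 D2 ->
    acLLp c[[(D1,, (D2,, D3))]] C -> acLLp c[[((D1,, D2),, D3)]] C
| i_A1R c D1 D2 D3 C : bang_lic axA1 D3 ->
    acLLp c[[((D1,, D2),, D3)]] C -> acLLp c[[(D1,, (D2,, D3))]] C
| i_A2L c D1 D2 D3 C : bang_lic axA2 D1 ->
    acLLp c[[(D1,, (D2,, D3))]] C -> acLLp c[[((D1,, D2),, D3)]] C
| i_A2M c D1 D2 D3 C : bang_lic axA2 D2 ->
    acLLp c[[((D1,, D2),, D3)]] C -> acLLp c[[(D1,, (D2,, D3))]] C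
| i_A2R c D1 D2 D3 C : bang_lic axA2 D3 ->
    acLLp c[[(D1,, (D2,, D3))]] C -> acLLp c[[((D1,, D2),, D3)]] C.

End Intuitionistic.

(** * The classical system CacLL *)

Inductive cform (Atom I : Type) : Type :=
| catom (p : Atom)
| cnatom (p : Atom)            (* [p^⊥] *)
| ctens (A B : cform Atom I)
| cpar (A B : cform Atom I)
| cwith (A B : cform Atom I)
| cplus (A B : cform Atom I)
| cbang (i : I) (A : cform Atom I)
| cquest (i : I) (A : cform Atom I)
| cone
| cbot
| ctop
| czero.

Arguments catom {Atom I} p.
Arguments cnatom {Atom I} p.
Arguments cone {Atom I}.
Arguments cbot {Atom I}.
Arguments ctop {Atom I}.
Arguments czero {Atom I}.

(** Formulas are in negation normal form; in the absence of commutativity,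
    negation reverses the order of the multiplicatives. *)
Fixpoint dual {Atom I : Type} (A : cform Atom I) : cform Atom I :=
  match A with
  | catom p => cnatom p
  | cnatom p => catom p
  | ctens A B => cpar (dual B) (dual A)
  | cpar A B => ctens (dual B) (dual A)
  | cwith A B => cplus (dual A) (dual B)
  | cplus A B => cwith (dual A) (dual B)
  | cbang i A => cquest i (dual A)
  | cquest i A => cbang i (dual A)
  | cone => cbot
  | cbot => cone
  | ctop => czero
  | czero => ctop
  end.

Section Classical.
Variables (Atom : Type) (Sg : signature).

Notation form := (cform Atom (label Sg)).

(** [quest_all P G] : every formula of [G] is of the form [?^j B] with [P j]. *)
Definition quest_all (P : label Sg -> Prop) : struct form -> Prop :=
  struct_all (fun A => match A with cquest j _ => P j | _ => False end).

Definition quest_lic (a : axm) : struct form -> Prop :=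
  quest_all (fun j => licenses Sg j a).

(** By [c_exch], [c_assoc] and [c_assoc'] a derivable sequent is an unrooted
    cyclically ordered binary tree: any of its edges can be made the root.
    [c_A1] and [c_A2] are the one-sided images of the rules A1L and A2R of the
    intuitionistic system; their other rootings are derivable. *)
Inductive CacLL : struct form -> Prop :=
| c_init A : CacLL (fml (dual A),, fml A)
| c_exch G D : CacLL (G,, D) -> CacLL (D,, G)
| c_assoc G D L : CacLL ((G,, D),, L) -> CacLL (G,, (D,, L))
| c_assoc' G D L : CacLL (G,, (D,, L)) -> CacLL ((G,, D),, L)
| c_tens G D A B :
    CacLL (G,, fml A) -> CacLL (D,, fml B) -> CacLL ((D,, G),, fml (ctens A B))
| c_par c A B :
    CacLL c[[(fml A,, fml B)]] -> CacLL c[[fml (cpar A B)]]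
| c_with c A B :
    CacLL c[[fml A]] -> CacLL c[[fml B]] -> CacLL c[[fml (cwith A B)]]
| c_plus1 c A B :
    CacLL c[[fml A]] -> CacLL c[[fml (cplus A B)]]
| c_plus2 c A B :
    CacLL c[[fml B]] -> CacLL c[[fml (cplus A B)]]
| c_one : CacLL (fml cone)
| c_bot c : CacLL c[[empty]] -> CacLL c[[fml cbot]]
| c_top c : CacLL c[[fml ctop]]
| c_bang i G A :
    quest_all (label_le Sg i) G ->
    CacLL (G,, fml A) -> CacLL (G,, fml (cbang i A))
| c_quest i c A :
    CacLL c[[fml A]] -> CacLL c[[fml (cquest i A)]]
| c_W c D :
    quest_lic axW D -> CacLL c[[empty]] -> CacLL c[[D]]
| c_C c D :
    quest_lic axC D -> CacLL c[[(D,, D)]] -> CacLL c[[D]]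
| c_E1 c D1 D2 : quest_lic axE D1 ->
    CacLL c[[(D2,, D1)]] -> CacLL c[[(D1,, D2)]]
| c_E2 c D1 D2 : quest_lic axE D1 ->
    CacLL c[[(D1,, D2)]] -> CacLL c[[(D2,, D1)]]
| c_A1 c D1 D2 D3 : quest_lic axA1 D3 ->
    CacLL c[[(D1,, (D2,, D3))]] -> CacLL c[[((D1,, D2),, D3)]]
| c_A2 c D1 D2 D3 : quest_lic axA2 D1 ->
    CacLL c[[((D1,, D2),, D3)]] -> CacLL c[[(D1,, (D2,, D3))]].

End Classical.

(** * The translation *)

Fixpoint hat {Atom I : Type} (A : iform Atom I) : cform Atom I :=
  match A with
  | iatom p => catom p
  | itens A B => ctens (hat A) (hat B)
  | ito A B => cpar (dual (hat A)) (hat B)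
  | ifrom B A => cpar (hat B) (dual (hat A))
  | iwith A B => cwith (hat A) (hat B)
  | iplus A B => cplus (hat A) (hat B)
  | ibang i A => cbang i (hat A)
  | ione => cone
  | itop => ctop
  end.

Fixpoint hat_dual_tree {Atom I : Type} (t : tree (iform Atom I)) :
    tree (cform Atom I) :=
  match t with
  | leaf A => leaf (dual (hat A))
  | node s t => node (hat_dual_tree t) (hat_dual_tree s)
  end.

(** [hat_dual G] is the structure written [\hat{G}^⊥]. *)
Definition hat_dual {Atom I : Type} (G : struct (iform Atom I)) :
    struct (cform Atom I) :=
  option_map hat_dual_tree G.

(* Main.v *)
(** Every classical sequent is read as an intuitionistic one, rooted at its
    unique output formula.  Formulas of the form [hat A] are outputs, those of
    the form [dual (hat A)] are inputs.  A structure without output is an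
    antecedent; a structure with one output [A] is an antecedent with a hole that
    waits for the rest of the sequent.  Pairing the readings of the two
    halves of a sequent is cyclic and associative, so the choice of a root does
    not matter, and every rule of CacLL becomes, according to the position of the
    output, a rule of acLL+.  Sequents with several outputs carry no information and are read
    as [True], but sequents without output are read as [False]: the
    absence of an intuitionistic 0 makes them underivable, which is what rules out
    premises with several outputs in the translations of [→] and [←]. *)

From Stdlib Require Import Setoid.
Require Import Defs.

Set Implicit Arguments.

Lemma comma_empty_r (F : Type) (G : struct F) : (G,, empty) = G.
Proof. destruct G; reflexivity. Qed.

Fixpoint ctx_comp {F : Type} (c d : ctx F) : ctx F :=
  match c with
  | hole _ => d
  | ctx_l c D => ctx_l (ctx_comp c d) D
  | ctx_r D c => ctx_r D (ctx_comp c d)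
  end.

Lemma plug_comp (F : Type) (c d : ctx F) (X : struct F) :
  (ctx_comp c d)[[X]] = c[[d[[X]]]].
Proof. induction c; simpl; congruence. Qed.

Lemma struct_all_comma (F : Type) (P : F -> Prop) (G D : struct F) :
  struct_all P (G,, D) <-> struct_all P G /\ struct_all P D.
Proof. destruct G, D; simpl; tauto. Qed.

#[local] Arguments comma {F} G D : simpl never.

(** * Polarities of classical formulas *)

Inductive polarity (Atom I : Type) : Type :=
| output (A : iform Atom I)
| input (A : iform Atom I)
| unpolarized.

Arguments unpolarized {Atom I}.

(** A partial inverse of both [hat] and [dual (hat _)], whose images are disjoint; a par of two
    outputs, for instance, lies in neither. *)
Fixpoint polarize {Atom I : Type} (A : cform Atom I) : polarity Atom I :=
  match A with
  | catom p => output (iatom p)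
  | cnatom p => input (iatom p)
  | ctens A B =>
      match polarize A, polarize B with
      | output a, output b => output (itens a b)
      | input b, output a => input (ito a b)
      | output a, input b => input (ifrom b a)
      | _, _ => unpolarized
      end
  | cpar A B =>
      match polarize A, polarize B with
      | input a, output b => output (ito a b)
      | output b, input a => output (ifrom b a)
      | input b, input a => input (itens a b)
      | _, _ => unpolarized
      end
  | cwith A B =>
      match polarize A, polarize B with
      | output a, output b => output (iwith a b)
      | input a, input b => input (iplus a b)
      | _, _ => unpolarized
      end
  | cplus A B =>
      match polarize A, polarize B with
      | output a, output b => output (iplus a b)
      | input a, input b => input (iwith a b)
      | _, _ => unpolarized
      end
  | cbang i A =>
      match polarize A with
      | output a => output (ibang i a)
      | _ => unpolarized
      end
  | cquest i A =>
      match polarize A with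
      | input a => input (ibang i a)
      | _ => unpolarized
      end
  | cone => output ione
  | cbot => input ione
  | ctop => output itop
  | czero => input itop
  end.

Lemma polarize_dual (Atom I : Type) (A : cform Atom I) :
  polarize (dual A) =
  match polarize A with
  | output a => input a
  | input a => output a
  | unpolarized => unpolarized
  end.
Proof.
  induction A; simpl; try reflexivity;
    try rewrite IHA; try rewrite IHA1, IHA2;
    repeat match goal with |- context [polarize ?A] => destruct (polarize A) end;
    reflexivity.
Qed.

Lemma polarize_hat (Atom I : Type) (A : iform Atom I) :
  polarize (hat A) = output A.
Proof.
  induction A; simpl; rewrite ?polarize_dual;
    try rewrite IHA; try rewrite IHA1, IHA2; reflexivity.
Qed.

(** [rinput G]: no output, the antecedent is [G].  [routput A k]: one output [A],
    and [k] is the antecedent with a hole for the rest of the sequent.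
    [rother]: several outputs, or a formula outside the image of the translation. *)
Inductive reading (Atom I : Type) : Type :=
| rinput (G : struct (iform Atom I))
| routput (A : iform Atom I) (k : ctx (iform Atom I))
| rother.

Arguments rother {Atom I}.

Definition read_form {Atom I : Type} (A : cform Atom I) : reading Atom I :=
  match polarize A with
  | output a => routput a (hole _)
  | input a => rinput (fml a)
  | unpolarized => rother
  end.

(** Two inputs swap because negation reverses order. Around an output the tree turns inside out:
    siblings nearer the root end up deeper, next to the hole. *)
Definition rcomma {Atom I : Type} (v w : reading Atom I) : reading Atom I :=
  match v, w with
  | rinput G, rinput D => rinput (D,, G)
  | routput A k, rinput D => routput A (ctx_comp k (ctx_l (hole _) D))
  | rinput G, routput A k => routput A (ctx_comp k (ctx_r G (hole _)))
  | _, _ => rother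
  end.

Fixpoint read_tree {Atom I : Type} (t : tree (cform Atom I)) : reading Atom I :=
  match t with
  | leaf A => read_form A
  | node s t => rcomma (read_tree s) (read_tree t)
  end.

Definition read {Atom I : Type} (G : struct (cform Atom I)) : reading Atom I :=
  match G with
  | None => rinput empty
  | Some t => read_tree t
  end.

Lemma read_hat_dual (Atom I : Type) (G : struct (iform Atom I)) :
  read (hat_dual G) = rinput G.
Proof.
  destruct G as [t|]; [|reflexivity]; simpl.
  induction t as [A|s IHs t IHt]; simpl.
  - unfold read_form; rewrite polarize_dual, polarize_hat; reflexivity.
  - rewrite IHs, IHt; reflexivity.
Qed.

(** * Cyclic pairing of readings *)

Section Soundness.
Variables (Atom : Type) (Sg : signature).

Notation rd := (reading Atom (label Sg)).
Notation cstruct := (struct (cform Atom (label Sg))).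

Definition pairing (v w : rd) : Prop :=
  match v, w with
  | rinput G, routput A k | routput A k, rinput G => acLLp Sg k[[G]] A
  | rinput _, rinput _ => False
  | _, _ => True
  end.

Lemma pairing_sym v w : pairing v w <-> pairing w v.
Proof. destruct v, w; simpl; tauto. Qed.

(** With exactly one output, both sides unfold to the same intuitionistic sequent; otherwise both
    are [True] or both [False]. *)
Lemma pairing_assoc v w u :
  pairing (rcomma v w) u <-> pairing v (rcomma w u).
Proof. destruct v, w, u; simpl; rewrite ?plug_comp; simpl; tauto. Qed.

Lemma pairing_rot v w u :
  pairing (rcomma v w) u <-> pairing w (rcomma u v).
Proof.
  rewrite pairing_assoc, pairing_sym, pairing_assoc; tauto.
Qed.

(** [read] does not commute with [comma] on the nose when one side is empty. *)
Lemma pairing_comma (G D : cstruct) u :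
  pairing (read (G,, D)) u <-> pairing (rcomma (read G) (read D)) u.
Proof.
  destruct G as [s|], D as [t|]; simpl; try tauto.
  - destruct (read_tree s), u; simpl; rewrite ?plug_comp; simpl;
      rewrite ?comma_empty_r; tauto.
  - destruct (read_tree t), u; simpl; rewrite ?plug_comp; simpl;
      rewrite ?comma_empty_r; tauto.
Qed.

(** Reroots at the hole: everything around it, including [u], is gathered in cyclic order into one
    reading. *)
Fixpoint outside (c : ctx (cform Atom (label Sg))) (u : rd) : rd :=
  match c with
  | hole _ => u
  | ctx_l c D => outside c (rcomma (read D) u)
  | ctx_r D c => outside c (rcomma u (read D))
  end.

Lemma pairing_plug c X u :
  pairing (read c[[X]]) u <-> pairing (read X) (outside c u).
Proof.
  revert u; induction c as [|c IH D|D c IH]; intros u; simpl.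
  - tauto.
  - rewrite pairing_comma, pairing_assoc; apply IH.
  - rewrite pairing_comma, pairing_rot; apply IH.
Qed.

Definition holds (G : cstruct) : Prop := pairing (read G) (rinput empty).

Lemma holds_plug c X :
  holds c[[X]] <-> pairing (read X) (outside c (rinput empty)).
Proof. apply pairing_plug. Qed.

Lemma holds_comma (G D : cstruct) :
  holds (G,, D) <-> pairing (read G) (read D).
Proof.
  unfold holds; rewrite pairing_comma.
  destruct (read G), (read D); simpl; rewrite ?plug_comp; simpl;
    rewrite ?comma_empty_r; tauto.
Qed.

Lemma holds_assoc (G D L : cstruct) :
  holds ((G,, D),, L) <-> holds (G,, (D,, L)).
Proof.
  rewrite !holds_comma, pairing_comma, pairing_rot.
  rewrite (pairing_sym (read G)), pairing_comma, pairing_assoc; tauto.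
Qed.

Lemma pairing_comma_l (G D L : cstruct) u :
  pairing (read ((G,, D),, L)) u <->
  pairing (rcomma (rcomma (read G) (read D)) (read L)) u.
Proof. rewrite pairing_comma, !(pairing_assoc _ (read L)); apply pairing_comma. Qed.

Lemma pairing_comma_r (G D L : cstruct) u :
  pairing (read (G,, (D,, L))) u <->
  pairing (rcomma (read G) (rcomma (read D) (read L))) u.
Proof. rewrite pairing_comma, !(pairing_rot (read G)); apply pairing_comma. Qed.

(** A formula [cquest j B] is never an output, so the structural rules only ever move inputs. *)
Lemma read_quest (P : label Sg -> Prop) (G : cstruct) :
  quest_all Sg P G ->
  read G = rother \/ exists D, read G = rinput D /\ bang_all Sg P D.
Proof.
  destruct G as [t|]; simpl.
  - induction t as [A|s IHs t IHt]; simpl.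
    + destruct A; try contradiction; intros HP.
      unfold read_form; simpl; destruct (polarize A); auto.
      right; eexists; split; [reflexivity|exact HP].
    + intros [Hs Ht].
      destruct (IHs Hs) as [->|(D & -> & HD)]; [left; reflexivity|].
      destruct (IHt Ht) as [->|(E & -> & HE)]; [left; reflexivity|].
      right; eexists; split; [reflexivity|].
      apply struct_all_comma; split; assumption.
  - right; exists empty; split; [reflexivity|exact I].
Qed.

Ltac focus :=
  repeat match goal with
  | |- holds _[[_]] => apply holds_plug
  | H : holds _[[_]] |- _ => apply holds_plug in H
  end;
  (* Premises and conclusion share their surroundings, so an arbitrary reading [u] can replace
     them. *)
  try (set (u := outside _ _) in *; clearbody u).

Ltac cases_polarity :=
  simpl in *; unfold read_form in *; simpl in *;
  repeat match goal with
  | |- context [polarize ?A] => destruct (polarize A)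
  | H : context [polarize ?A] |- _ => destruct (polarize A)
  end; simpl in *.

Ltac cases_quest H :=
  let D := fresh "D" in let HD := fresh "HD" in let E := fresh "E" in
  apply read_quest in H; destruct H as [E|(D & E & HD)].

Theorem CacLL_holds G : CacLL Sg G -> holds G.
Proof.
  induction 1; focus.
  - apply holds_comma; unfold read, fml, read_tree, read_form.
    rewrite polarize_dual; destruct (polarize A); simpl; auto using i_init.
  - apply holds_comma, pairing_sym, holds_comma; assumption.
  - apply holds_assoc; assumption.
  - apply holds_assoc; assumption.
  (* When one factor is an input and the premise of the output factor has two outputs, the
     conclusion may have only one; then the other premise has none and is [False]. *)
  - apply holds_comma, pairing_comma; apply holds_comma in IHCacLL1, IHCacLL2.
    cases_polarity; destruct (read G), (read D); simpl in *; try tauto;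
      rewrite ?plug_comp; simpl; auto using i_tensR, i_toL, i_fromL.
  - apply pairing_comma in IHCacLL.
    cases_polarity; destruct u; simpl in *; rewrite ?plug_comp in *; simpl in *;
      auto using i_tensL, i_toR, i_fromR.
  - cases_polarity; destruct u; simpl in *; auto using i_withR, i_plusL.
  - cases_polarity; destruct u; simpl in *; auto using i_plusR1, i_withL1.
  - cases_polarity; destruct u; simpl in *; auto using i_plusR2, i_withL2.
  - apply i_oneR.
  - destruct u; simpl in *; auto using i_oneL.
  - destruct u; simpl in *; auto using i_topR.
  - apply holds_comma; apply holds_comma in IHCacLL.
    cases_quest H; rewrite E in *; [exact I|].
    cases_polarity; auto using i_bangR.
  - cases_polarity; destruct u; simpl in *; auto using i_bangL; tauto.
  - cases_quest H; rewrite E in *; [exact I|].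
    destruct u; simpl in *; auto using i_W.
  - apply pairing_comma in IHCacLL.
    cases_quest H; rewrite E in *; [exact I|].
    destruct u; simpl in *; auto using i_C.
  (* With the output in [D2], it is [u] that [D1] is exchanged with. *)
  - apply pairing_comma; apply pairing_comma in IHCacLL.
    cases_quest H; rewrite E in *; [exact I|].
    destruct (read D2), u; simpl in *; rewrite ?plug_comp in *; simpl in *;
      auto using i_E1, i_E2.
  - apply pairing_comma; apply pairing_comma in IHCacLL.
    cases_quest H; rewrite E in *; [destruct (read D2); exact I|].
    destruct (read D2), u; simpl in *; rewrite ?plug_comp in *; simpl in *;
      auto using i_E1, i_E2.
  (* An output in [u], [D1] or [D2] gives A1L, A1M or A1R respectively. *)
  - apply pairing_comma_l; apply pairing_comma_r in IHCacLL.
    cases_quest H; rewrite E in *;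
      [destruct (rcomma (read D1) (read D2)); exact I|].
    destruct (read D1), (read D2), u; simpl in *;
      rewrite ?plug_comp in *; simpl in *; rewrite ?plug_comp in *; simpl in *;
      auto using i_A1L, i_A1M, i_A1R.
  (* An output in [u], [D3] or [D2] gives A2R, A2M or A2L respectively. *)
  - apply pairing_comma_r; apply pairing_comma_l in IHCacLL.
    cases_quest H; rewrite E in *; [exact I|].
    destruct (read D2), (read D3), u; simpl in *;
      rewrite ?plug_comp in *; simpl in *; rewrite ?plug_comp in *; simpl in *;
      auto using i_A2L, i_A2M, i_A2R.
Qed.

End Soundness.

Theorem theorem3p2 (Atom : Type) (Sigma : signature)
    (Gamma : struct (iform Atom (label Sigma))) (A : iform Atom (label Sigma)) :
  CacLL Sigma (hat_dual Gamma,, fml (hat A)) -> acLLp Sigma Gamma A.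
Proof.
  intros H; apply CacLL_holds, holds_comma in H.
  rewrite read_hat_dual in H; simpl in H.
  unfold read_form in H; rewrite polarize_hat in H; exact H.
Qed.
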